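(* Consider the linear closed-loop system with state $(\hat\omega,\hat V,\eta,\phi'')\in\mathbb{R}^n\times\mathbb{R}^n\times\mathbb{R}^n\times\mathbb{R}^{n-1}$ given by $$\begin{aligned} \dot{\hat\omega} &= M\Big(-(K^{\mathrm{droop}}+K^\omega)\hat\omega + K^V\hat V - K^V(K^\omega)^{-1}K^{\mathrm{droop,I}}\eta - \mathcal{L}_\phi S\phi'' + P^m\Big),\\ \dot{\hat V} &= \frac{1}{V^{\mathrm{nom}}}EK^\omega\hat\omega - E\Big(\mathcal{L}_R+\frac{K^V}{V^{\mathrm{nom}}}\Big)\hat V + \frac{1}{V^{\mathrm{nom}}}E\mathcal{L}_\phi S\phi'',\\ \dot\eta &= K^{\mathrm{droop,I}}\hat\omega - \mathcal{L}_\eta\eta,\\ \dot\phi'' &= S^T(K^V)^{-1}K^\omega\hat\omega - \gamma\phi''. \end{aligned}$$ Suppose that $\mathcal{L}_\phi = k_\phi\mathcal{L}_R$ for a constant $k_\phi$, and that $\gamma > k_\phi/(4V^{\mathrm{nom}})$. Then the equilibrium of this system is globally asymptotically stable.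
   Context: The system models $n$ HVDC converters, each connected to a single-generator AC system. $M=\mathrm{diag}(m_1^{-1},\dots,m_n^{-1})$ with $m_i>0$; $E=\mathrm{diag}(C_1^{-1},\dots,C_n^{-1})$ with $C_i>0$; $V^{\mathrm{nom}}>0$ is a constant (nominal DC voltage). $K^\omega,K^V,K^{\mathrm{droop}},K^{\mathrm{droop,I}}$ are $n\times n$ diagonal matrices with positive diagonal entries (controller gains). $P^m\in\mathbb{R}^n$ is a constant vector. $\mathcal{L}_R$ is the weighted Laplacian of the connected undirected graph of the MTDC (multi-terminal HVDC) grid on vertices $1,\dots,n$, with edge weights $1/R_{ij}>0$. $\mathcal{L}_\eta$ and $\mathcal{L}_\phi$ are the weighted Laplacians of undirected communication graphs on $1,\dots,n$, with edge weights $c^\eta_{ij}=c^\eta_{ji}>0$ and $c^\phi_{ij}=c^\phi_{ji}>0$, respectively. $1_n$ denotes the all-ones vector in $\mathbb{R}^n$, and $S$ is an $n\times(n-1)$ matrix such that $\left[\tfrac{1}{\sqrt n}1_n\;\; S\right]$ is an orthogonal matrix. *)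

(* Defs.v *)
From mathcomp Require Import all_boot all_order all_algebra.
From mathcomp Require Import all_classical all_reals all_analysis.

Set Implicit Arguments.
Unset Strict Implicit.
Unset Printing Implicit Defensive.

Import Order.TTheory GRing.Theory Num.Theory.
Import numFieldNormedType.Exports.

Local Open Scope classical_set_scope.
Local Open Scope ring_scope.

Definition weighted_graph (R : numDomainType) n (e : rel 'I_n)
    (w : 'I_n -> 'I_n -> R) : Prop :=
  [/\ symmetric e, irreflexive e &
      forall i j, e i j -> w i j = w j i /\ 0 < w i j].

Definition graph_connected n (e : rel 'I_n) : Prop :=
  forall i j, connect e i j.

(* The values of [w] outside the edge set [e] are ignored. *)
Definition laplacian (R : pzRingType) n (e : rel 'I_n)
    (w : 'I_n -> 'I_n -> R) : 'M[R]_n :=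
  \matrix_(i, j) ((\sum_(k < n | e i k) w i k) *+ (i == j)
                  - w i j *+ e i j).

Definition pos_diag_mx (R : numDomainType) n (A : 'M[R]_n) : Prop :=
  is_diag_mx A /\ forall i, 0 < A i i.

(* The two dimensions are kept separate so that this applies to
   [row_mx u S : 'M_(n, 1 + n.-1)] without a cast; the two equations together
   force them to be equal. *)
Definition orthogonal_mx (R : comPzRingType) p q (Q : 'M[R]_(p, q)) : Prop :=
  Q^T *m Q = 1%:M /\ Q *m Q^T = 1%:M.

Section Stability.
Context {R : realType} {V : normedModType R}.
Implicit Types (F : V -> V) (x : R -> V).

(* Values of [x] at negative times are irrelevant: at time 0 only continuity
   from the right is required. *)
Definition is_solution F x : Prop :=
  {within `[0, +oo[, continuous x} /\
  forall t : R, 0 < t -> is_derive t 1 x (F (x t)).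

Definition is_equilibrium F (xe : V) : Prop := F xe = 0.

Definition lyapunov_stable F (xe : V) : Prop :=
  forall eps : R, 0 < eps -> exists2 delta : R, 0 < delta &
    forall x, is_solution F x -> `|x 0 - xe| < delta ->
      forall t : R, 0 <= t -> `|x t - xe| < eps.

Definition globally_attractive F (xe : V) : Prop :=
  forall x, is_solution F x -> x t @[t --> +oo] --> xe.

(* Without forward completeness, the other two conditions, which quantify over
   solutions defined on [0, +oo[, could hold vacuously. *)
Definition forward_complete F : Prop :=
  forall x0 : V, exists2 x, is_solution F x & x 0 = x0.

Definition globally_asymptotically_stable F (xe : V) : Prop :=
  [/\ is_equilibrium F xe, forward_complete F,
      lyapunov_stable F xe & globally_attractive F xe].

End Stability.

Notation state R n := ('cV[R]_n * 'cV[R]_n * 'cV[R]_n * 'cV[R]_n.-1)%type.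

Definition closed_loop (R : realType) (n : nat)
    (M E Komega KV Kdroop KdroopI LR Leta Lphi : 'M[R]_n)
    (S : 'M[R]_(n, n.-1)) (Pm : 'cV[R]_n) (Vnom gamma : R)
    (x : state R n) : state R n :=
  let: (omega, volt, eta, phi) := x in
  (M *m (- ((Kdroop + Komega) *m omega) + KV *m volt
         - KV *m invmx Komega *m KdroopI *m eta - Lphi *m S *m phi + Pm),
   Vnom^-1 *: (E *m Komega *m omega)
     - E *m (LR + Vnom^-1 *: KV) *m volt
     + Vnom^-1 *: (E *m Lphi *m S *m phi),
   KdroopI *m omega - Leta *m eta,
   S^T *m invmx KV *m Komega *m omega - gamma *: phi).

(* Main.v *)
From HB Require Import structures.
Require Import Defs.
From mathcomp Require Import all_boot all_order all_algebra.
From mathcomp Require Import all_classical all_reals all_analysis.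
From mathcomp Require Import ring lra.
Import Order.TTheory GRing.Theory Num.Theory.
Import numFieldNormedType.Exports.
Set Implicit Arguments.
Unset Strict Implicit.
Unset Printing Implicit Defensive.
Local Open Scope classical_set_scope.
Local Open Scope ring_scope.

(** The shift [y = x - xe] turns the system into the linear one [y' = L y], and
    a quadratic form [B] with [a |y|^2 <= B y y] and
    [2 B y (L y) <= - c |y|^2] is strictly positive and strictly decreasing.
    Such a [B] makes [L] injective, hence the equilibrium unique and existent,
    and gives exponential decay of every solution.

    Let [kw], [kv], [kd], [ki] be the diagonal entries of [Komega], [KV],
    [Kdroop], [KdroopI], [z = Lphi S phi] and [psi = S phi].  The energy
      [sum (kw m / kv) w^2 + Vnom sum C V^2 + |eta|^2 + psi . Lphi psi]
    has half derivative
      [- sum (kw w - kv V)^2 / kv - sum (kw kd / kv) w^2 - eta . Leta eta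
       - (Vnom V . LR V - V . z + gamma psi . z)],
    where the last bracket is a form in [V] and [psi] with respect to [LR],
    nonnegative because [0 <= kphi <= 4 Vnom gamma].  This only dissipates
    [w] and [V].  Adding [b |phi|^2] and then [2 eps sum nu w eta], where
    [nu = m kw / (kv ki)], with [b] and next [eps] small, makes the
    dissipation strict in [phi] and [eta], so no invariance principle is
    needed. *)

(** * Linear differential equations *)

(** Once the direction [h%:A] is simplified to [h], a derivative along a real parameter can be
    obtained by rewriting its difference quotient and taking a limit. *)
Lemma is_derive_cvg (R : realType) (V : normedModType R) (x : R -> V)
    (t : R) (v : V) :
  h^-1 *: (x (h + t) - x t) @[h --> 0^'] --> v <-> is_derive t 1 x v.
Proof.
have E : (fun h : R => h^-1 *: ((x \o shift t) h%:A - x t)) =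
         (fun h => h^-1 *: (x (h + t) - x t)).
  by apply/funext => h; rewrite /= [h%:A]mulr1.
split=> [H|[dx <-]].
  by apply: DeriveDef; rewrite /derivable /derive E;
    [apply/cvg_ex; exists v | apply: cvg_lim].
by rewrite /derive E; move: dx; rewrite /derivable E.
Qed.

Lemma is_derive_linear (R : realType) (V W : normedModType R)
    (f : {linear V -> W}) (x : R -> V) (t : R) (v : V) :
  continuous f -> is_derive t 1 x v -> is_derive t 1 (f \o x) (f v).
Proof.
move=> fc /is_derive_cvg xv; apply/is_derive_cvg.
have -> : (fun h : R => h^-1 *: ((f \o x) (h + t) - (f \o x) t)) =
          f \o (fun h => h^-1 *: (x (h + t) - x t)).
  by apply/funext => h; rewrite /= linearZ/= (linearB f).
exact: (continuous_cvg _ (fc v) xv).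
Qed.

Lemma is_derive_scalel (R : realType) (V : normedModType R) (f : R -> R)
    (t df : R) (v : V) :
  is_derive t 1 f df -> is_derive t 1 (fun s => f s *: v) (df *: v).
Proof.
move=> /is_derive_cvg fv; apply/is_derive_cvg.
have -> : (fun h : R => h^-1 *: (f (h + t) *: v - f t *: v)) =
          (fun h => (h^-1 *: (f (h + t) - f t)) *: v).
  by apply/funext => h /=; rewrite -scalerBl scalerA.
exact: cvgZr_tmp.
Qed.

Lemma is_derive_bigsum (R : realType) (V : normedModType R) (I : finType)
    (f : I -> R -> V) (t : R) (df : I -> V) :
  (forall i, is_derive t 1 (f i) (df i)) ->
  is_derive t 1 (fun s => \sum_i f i s) (\sum_i df i).
Proof.
move=> fdf; have -> : (fun s => \sum_i f i s) = \sum_i f i.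
  by apply/funext => s; rewrite fct_sumE.
by elim/big_ind2 : _ => // *; [exact: is_derive_cst|exact: is_deriveD].
Qed.

(** Termwise comparison with [s] times the exponential series at [|K| |x|]. *)
Lemma is_cvg_pseries_geometric_fact (R : realType) (a : R^nat) (s K x : R) :
  (forall k, `|a k| <= s * K ^+ k) ->
  cvgn (pseries (fun k => a k / k`!%:R) x).
Proof.
move=> aK; apply: normed_cvg.
have s0 : 0 <= s by have := aK 0; rewrite expr0 mulr1; apply: le_trans.
have K0 : 0 <= s * K by have := aK 1; rewrite expr1; apply: le_trans.
apply: (@series_le_cvg _ _ (fun k => s * exp_coeff (`|K| * `|x|) k))
  => [k|k|k|].
- exact: normr_ge0.
- by rewrite mulr_ge0// exp_coeff_ge0// mulr_ge0.
- rewrite /= /exp_coeff /= !normrM normfV normrX exprMn [`|_%:R|]ger0_norm//.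
  rewrite mulrAC !mulrA ler_wpM2r ?invr_ge0// ler_wpM2r ?exprn_ge0//.
  apply: le_trans (aK k) _; rewrite ler_wpM2l// -normrX; exact: ler_norm.
- exact/is_cvg_seriesZ/is_cvg_series_exp_coeff.
Qed.

(** Differentiating a series in [t ^ k / k!] shifts the sequence [a] by one, which preserves a
    geometric bound with [s] replaced by [s * K]. Hence the series and its first two formal
    derivatives converge at [|t| + 1], which justifies termwise differentiation at [t]. *)
Lemma is_derive_pseries_fact (R : realType) (a : R^nat) (s K : R) (t : R) :
  (forall k, `|a k| <= s * K ^+ k) ->
  is_derive t 1 (fun t => limn (pseries (fun k => a k / k`!%:R) t))
    (limn (pseries (fun k => a k.+1 / k`!%:R) t)).
Proof.
move=> aK.
have dE (b : R^nat) : pseries_diffs (fun k => b k / k`!%:R) =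
                      fun k => b k.+1 / k`!%:R.
  apply/funext => k; rewrite /pseries_diffs factS natrM invfM.
  by rewrite mulrCA mulVKf.
have shK (b : R^nat) r : (forall k, `|b k| <= r * K ^+ k) ->
    forall k, `|b k.+1| <= r * K * K ^+ k.
  by move=> bK k; rewrite -mulrA -exprS.
rewrite -dE; apply: (@pseries_snd_diffs _ _ (`|t| + 1)); rewrite ?dE.
- exact: is_cvg_pseries_geometric_fact aK.
- exact: is_cvg_pseries_geometric_fact (shK _ _ aK).
- exact: is_cvg_pseries_geometric_fact (shK _ _ (shK _ _ aK)).
- by rewrite [ltRHS]ger0_norm// ltrDl.
Qed.

(** * Finite-dimensional spaces through vectors [e i] and coordinate maps [p i] *)

Section Coordinates.
Context {R : realType} {V : normedModType R} {I : finType}.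
Variables (e : I -> V) (p : I -> {linear V -> R^o}).
Hypothesis coordK : forall v, v = \sum_i p i v *: e i.

Lemma linear_coordE (W : lmodType R) (f : {linear V -> W}) (v : V) :
  f v = \sum_i p i v *: f (e i).
Proof.
by rewrite {1}[v]coordK linear_sum; apply: eq_bigr => i _; rewrite linearZ.
Qed.

(** The solution is the exponential of [t L] applied to [y0], built coordinatewise: [c i k] is the
    [i]-th coordinate of the [k]-th iterate [L^k y0], and [f i] is the sum of the
    [c i k * t ^ k / k!]. With [A] the matrix of [L] and [K] the sum of its absolute entries, the
    coefficients grow at most geometrically. *)
Lemma linear_ode_solution (L : {linear V -> V}) (y0 : V) :
  exists2 y : R -> V, y 0 = y0 & forall t : R, is_derive t 1 y (L (y t)).
Proof.
pose c i k : R := p i (iter k L y0).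
pose s k : R := \sum_i `|c i k|.
pose A i j : R := p i (L (e j)).
pose K : R := \sum_i \sum_j `|A i j|.
have cS i k : c i k.+1 = \sum_j c j k * A i j.
  exact: (linear_coordE (p i \o L : {linear V -> R^o})).

have c_le i k : `|c i k| <= s k by rewrite /s (bigD1 i)//= lerDl sumr_ge0.
have sK k : s k <= s 0 * K ^+ k.
  elim: k => [|k IH]; first by rewrite mulr1.
  rewrite exprSr mulrA; apply: (@le_trans _ _ (s k * K)); last first.
    by rewrite ler_wpM2r// sumr_ge0// => i _; rewrite sumr_ge0.
  rewrite {1}/s mulr_sumr; apply: ler_sum => i _.
  rewrite cS (le_trans (ler_norm_sum _ _ _))// mulr_sumr; apply: ler_sum => j _.
  by rewrite normrM ler_wpM2r.
have cK i k : `|c i k| <= s 0 * K ^+ k by exact: le_trans (c_le i k) (sK k).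
pose f i (t : R) : R := limn (pseries (fun k => c i k / k`!%:R) t).
have df i (t : R) : is_derive t 1 (f i) (\sum_j f j t * A i j).
  have /is_derive_eq := is_derive_pseries_fact t (cK i); apply.
  apply: cvg_lim => //.
  have -> : pseries (fun k => c i k.+1 / k`!%:R) t =
      fun n => \sum_j pseries (fun k => c j k / k`!%:R) t n * A i j.
    apply/funext => n; rewrite /pseries /series /=.
    under [RHS]eq_bigr do rewrite mulr_suml.
    rewrite exchange_big; apply: eq_bigr => k _ /=; rewrite cS !mulr_suml.
    by apply: eq_bigr => j _; ring.
  apply: cvg_big => [|j _]; first exact: add_continuous.
  apply: cvgM; last exact: cvg_cst.
  exact: is_cvg_pseries_geometric_fact (cK j).
exists (fun t => \sum_i f i t *: e i) => [|t].
  rewrite [y0 in RHS]coordK; apply: eq_bigr => i _; congr (_ *: _).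
  (* At time 0 the partial sum of index 0 is empty, but all later ones equal the constant term
     [p i y0]; hence the shift. *)
  apply: cvg_lim => //; rewrite -cvg_shiftS.
  have -> : [sequence pseries (fun k => c i k / k`!%:R) 0 n.+1]_n =
      fun=> p i y0.
    apply/funext => n.
    rewrite /pseries /series /= big_nat_recl//= big1 => [|k _].
      by rewrite addr0 mulr1 divr1.
    by rewrite expr0n mulr0.
  exact: cvg_cst.
have ydf := is_derive_bigsum (fun i => is_derive_scalel (e i) (df i t)).
apply: is_derive_eq ydf _.
rewrite linear_sum; under eq_bigr do rewrite scaler_suml.
rewrite exchange_big; apply: eq_bigr => j _ /=.
rewrite linearZ/= [L (e j) in RHS]coordK scaler_sumr.
by apply: eq_bigr => i _; rewrite scalerA.
Qed.

End Coordinates.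

(** * Lyapunov's theorem for quadratic forms *)

(** The product [h t = g t * expR (k * t)] has derivative [(dg t + k * g t) * expR (k * t) <= 0], so
    it never exceeds its value at 0. *)
Lemma gronwall_decay (R : realType) (g dg : R -> R) (k : R) :
  {within `[0, +oo[, continuous g} ->
  (forall t : R, 0 < t -> is_derive t 1 g (dg t)) ->
  (forall t, 0 < t -> dg t <= - k * g t) ->
  forall t, 0 <= t -> g t * expR (k * t) <= g 0.
Proof.
move=> gc gd gle t t0.
pose h t := g t * expR (k * t).
have hd (s : R) : 0 < s -> is_derive s 1 h ((dg s + k * g s) * expR (k * s)).
  move=> /gd gds.
  have ed : is_derive s 1 (fun s => expR (k * s)) (expR (k * s) * k).
    apply: (@is_derive1_comp _ expR ( *%R k)).
    apply: is_derive_eq (is_deriveZ k (is_derive_id s 1)) _.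
    by rewrite /= [_ *: _]mulr1.
  apply: is_derive_eq (is_deriveM gds ed) _.
  by rewrite /GRing.scale/=; ring.
have hc : {within `[0, +oo[, continuous h}.
  have ec : continuous (fun s : R => expR (k * s)).
    move=> s; apply: continuous_comp; last exact: continuous_expR.
    exact: mulrl_continuous.
  move=> s; apply: cvgM; first exact: gc.
  exact: (continuous_subspaceT ec).
have -> : g 0 = h 0 by rewrite /h mulr0 expR0 mulr1.
apply: (ler0_derive1_nincry _ _ hc) => // s; rewrite in_itv/= andbT => s0.
  by case: (hd s s0).
rewrite derive1E; case: (hd s s0) => _ ->.
by rewrite mulr_le0_ge0 ?expR_ge0//; have := gle s s0; lra.
Qed.

Section Lyapunov.
Context {R : realType} {V : normedModType R} {I : finType}.
Variables (e : I -> V) (p : I -> {linear V -> R^o}).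
Hypothesis coordK : forall v, v = \sum_i p i v *: e i.
Hypothesis coord_cont : forall i, continuous (p i).

(** A Euclidean substitute for the squared norm: the norm of [V] is arbitrary, whereas quadratic
    forms compare directly with [sq]. *)
Let sq (v : V) : R := \sum_i (p i v : R) ^+ 2.

Lemma coord_sqr_le i v : (p i v : R) ^+ 2 <= sq v.
Proof.
by rewrite /sq (bigD1 i)//= lerDl sumr_ge0// => j _; rewrite sqr_ge0.
Qed.

(** Every coordinate is at most [r] in absolute value, and the triangle inequality concludes. The
    summand [1] makes the bound strict and the constant positive even if all [e i] vanish. *)
Lemma norm_lt_of_coords (r : R) (v : V) :
  0 < r -> sq v < r ^+ 2 -> `|v| < (1 + \sum_i `|e i|) * r.
Proof.
move=> r0 vr; rewrite mulrDl mul1r; apply: ltr_pwDl => //.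
rewrite {1}[v]coordK (le_trans (ler_norm_sum _ _ _))// mulr_suml.
apply: ler_sum => i _; rewrite normrZ mulrC ler_wpM2l//.
rewrite -(@ler_pXn2r _ 2) ?nnegrE ?(ltW r0)// real_normK ?num_real//.
exact: le_trans (coord_sqr_le i v) (ltW vr).
Qed.

Section Form.
Variable B : V -> V -> R.
Hypothesis linBl : forall v, linear (B^~ v : V -> R^o).
Hypothesis linBr : forall u, linear (B u : V -> R^o).

Lemma form_coordE u v :
  B u v = \sum_i \sum_j (p i u : R) * (p j v : R) * B (e i) (e j).
Proof.
pose f w : {linear V -> R^o} :=
  HB.pack (B^~ w : V -> R^o) (GRing.isLinear.Build _ _ _ _ _ (linBl w)).
pose g w : {linear V -> R^o} :=
  HB.pack (B w : V -> R^o) (GRing.isLinear.Build _ _ _ _ _ (linBr w)).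
rewrite (linear_coordE coordK (f v) u : B u v = _); apply: eq_bigr => i _.
rewrite [f v (e i)](linear_coordE coordK (g (e i)) v) scaler_sumr.
by apply: eq_bigr => j _; rewrite scalerA.
Qed.

(** In coordinates the form is a finite sum of products of scalar functions, so the scalar product
    rule suffices. *)
Lemma is_derive_form (x : R -> V) (t : R) (v : V) :
  is_derive t 1 x v ->
  is_derive t 1 (fun s => B (x s) (x s)) (B v (x t) + B (x t) v).
Proof.
move=> xv.
have -> : (fun s => B (x s) (x s)) = fun s => \sum_i \sum_j
    ((p i (x s) : R) * (p j (x s) : R)) *: (B (e i) (e j) : R^o).
  by apply/funext => s; rewrite form_coordE.
have pd i := is_derive_linear (@coord_cont i) xv.
have H i j := is_derive_scalel (B (e i) (e j) : R^o) (is_deriveM (pd i) (pd j)).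
apply: is_derive_eq (is_derive_bigsum (fun i => is_derive_bigsum (H i))) _.
rewrite !form_coordE -big_split; apply: eq_bigr => i _; rewrite -big_split.
by apply: eq_bigr => j _; rewrite /GRing.scale/=; ring.
Qed.

Lemma form_continuous : continuous (fun v => B v v).
Proof.
have -> : (fun v => B v v) = fun v => \sum_i \sum_j
    (p i v : R) * (p j v : R) * B (e i) (e j).
  by apply/funext => s; rewrite form_coordE.
move=> v; apply: cvg_big => [|i _]; first exact: add_continuous.
apply: cvg_big => [|j _]; first exact: add_continuous.
apply: cvgM; last exact: cvg_cst.
by apply: cvgM; exact: coord_cont.
Qed.

Lemma form_le_sq v : B v v <= (1 + \sum_i \sum_j `|B (e i) (e j)|) * sq v.
Proof.
have sq0 : 0 <= sq v by apply: sumr_ge0 => i _; rewrite sqr_ge0.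
rewrite form_coordE mulrDl mul1r; apply: ler_wpDl => //.
rewrite mulr_suml; apply: ler_sum => i _.
rewrite mulr_suml; apply: ler_sum => j _.
apply: le_trans (ler_norm _) _; rewrite normrM mulrC ler_wpM2l//.
have := coord_sqr_le i v; have := coord_sqr_le j v.
by rewrite ler_norml; set a : R := p i v; set b : R := p j v; nra.
Qed.

End Form.

(** Since [W <= b * sq], the dissipation bound gives [W' <= - (c / b) * W] along [x - xe], hence
    exponential decay of [W]. The lower bound [a * sq <= W] carries this over to the norm. *)
Lemma lyapunov_linear (L : {linear V -> V}) (B : V -> V -> R) (xe : V)
    (a c : R) :
  (forall v, linear (B^~ v : V -> R^o)) ->
  (forall u, linear (B u : V -> R^o)) ->
  0 < a -> 0 < c ->
  (forall v, a * sq v <= B v v) ->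
  (forall v, B (L v) v + B v (L v) <= - c * sq v) ->
  globally_asymptotically_stable (fun x => L (x - xe)) xe.
Proof.
move=> linBl linBr a0 c0 Bpos BL.
pose W v := B v v.
pose b : R := 1 + \sum_i \sum_j `|B (e i) (e j)|.
have b0 : 0 < b by apply: ltr_pwDl => //; do 2!apply: sumr_ge0 => ? _.
pose C : R := 1 + \sum_i `|e i|.
have C0 : 0 < C by apply: ltr_pwDl => //; apply: sumr_ge0.
have Wc : continuous W := form_continuous linBl linBr.
have W0 : W 0 = 0.
  rewrite /W (form_coordE linBl linBr) big1// => i _; rewrite big1// => j _.
  by rewrite linear0 !mul0r.
have decay x : is_solution (fun x => L (x - xe)) x -> forall t, 0 <= t ->
    W (x t - xe) * expR (c / b * t) <= W (x 0 - xe).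
  move=> [xc xd].
  pose y t := x t - xe.
  have yd (t : R) : 0 < t -> is_derive t 1 y (L (y t)).
    move=> /xd xdt.
    apply: is_derive_eq (is_deriveB xdt (is_derive_cst xe t 1)) _.
    by rewrite subr0.
  have yc : {within `[0, +oo[, continuous y}.
    apply: within_continuousB xc _; apply: continuous_subspaceT => ?.
    exact: cvg_cst.
  apply: (@gronwall_decay _ (W \o y)
    (fun t => B (L (y t)) (y t) + B (y t) (L (y t)))).
  - by apply: within_continuous_comp yc => z _; exact: Wc.
  - by move=> t t0; exact: (is_derive_form linBl linBr (yd t t0)).
  - move=> t t0; apply: le_trans (BL _) _.
    rewrite !mulNr lerN2 /= -mulrA ler_pM2l// ler_pdivrMl//.
    exact: form_le_sq.
(* The sublevel set of [W] at height [a * (eps / C) ^+ 2] lies in the open ball of radius [eps]. *)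
have small (eps : R) v : 0 < eps -> W v < a * (eps / C) ^+ 2 -> `|v| < eps.
  move=> eps0 Wv; rewrite -[ltRHS](divfK (lt0r_neq0 C0)) mulrC.
  apply: norm_lt_of_coords; first exact: divr_gt0.
  by rewrite -(ltr_pM2l a0); apply: le_lt_trans (Bpos v) Wv.
have Wge0 v : 0 <= W v.
  apply: le_trans (Bpos v); rewrite mulr_ge0 ?(ltW a0)// sumr_ge0// => i _.
  by rewrite sqr_ge0.
split.
- by rewrite /is_equilibrium subrr linear0.
- move=> x0; have [y y0 yd] := linear_ode_solution coordK L (x0 - xe).
  have xd (t : R) : is_derive t 1 (fun t => y t + xe) (L (y t + xe - xe)).
    apply: is_derive_eq (is_deriveD (yd t) (is_derive_cst xe t 1)) _.
    by rewrite addr0 addrK.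
  exists (fun t => y t + xe); last by rewrite y0 subrK.
  split=> [|t _]; last exact: xd.
  apply: continuous_subspaceT => t; apply/differentiable_continuous.
  by apply/derivable1_diffP; case: (xd t).
- move=> eps eps0.
  have r0 : 0 < a * (eps / C) ^+ 2 by rewrite mulr_gt0// exprn_gt0// divr_gt0.
  (* Continuity of [W] at 0 provides [d]: a start within [d] lies in that sublevel set, and [W]
     never exceeds its initial value. *)
  have := Wc 0; rewrite /continuous_at W0 => /cvgrPdist_lt/(_ _ r0).
  move=> /nbhs_ballP[d /= d0 dW]; exists d => // x xs xd t t0.
  apply: small => //; apply: le_lt_trans (_ : W (x 0 - xe) < _).
    apply: le_trans (decay x xs t t0); apply: ler_peMr => //.
    rewrite (le_trans _ (expR_ge1Dx _))// lerDl mulr_ge0// divr_ge0 ?ltW//.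
  have := dW (x 0 - xe); rewrite -ball_normE /ball_ /= sub0r normrN => /(_ xd).
  by rewrite sub0r normrN ger0_norm.
- move=> x xs; apply/cvgrPdist_lt => eps eps0.
  pose r := a * (eps / C) ^+ 2.
  have r0 : 0 < r by rewrite mulr_gt0// exprn_gt0// divr_gt0.
  near=> t; rewrite distrC; apply: small => //; rewrite -/r.
  have t0 : 0 <= t by near: t; apply: nbhs_pinfty_ge; rewrite num_real.
  have := decay x xs t t0; set w := W (x t - xe); set k := c / b * t => wk.
  (* At such a late time, [r <= w] would give [r * (1 + k) <= w * expR k <= W (x 0 - xe) < k * r],
     which is absurd. *)
  have k0 : W (x 0 - xe) / r < k.
    rewrite /k -ltr_pdivrMl ?divr_gt0//; near: t.
    by apply: nbhs_pinfty_gt; rewrite num_real.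
  rewrite ltr_pdivrMr// in k0.
  have e1 := expR_ge1Dx k.
  rewrite ltNge; apply/negP => rw.
  suff : r * (1 + k) <= w * expR k by lra.
  have kr : 0 <= k by rewrite mulr_ge0// divr_ge0 ?ltW.
  by apply: ler_pM => //; [exact: ltW | lra].
Unshelve. all: by end_near. Qed.

End Lyapunov.

(** * Dot products and Laplacians *)

Definition dot (R : pzRingType) k (u v : 'cV[R]_k) : R := \sum_i u i 0 * v i 0.

Section Dot.
Context {R : comPzRingType} {k l : nat}.
Implicit Types (u v w : 'cV[R]_k).

Lemma dotC u v : dot u v = dot v u.
Proof. by apply: eq_bigr => i _; rewrite mulrC. Qed.

Lemma dot_linear u (a : R) v w : dot u (a *: v + w) = a * dot u v + dot u w.
Proof.
rewrite /dot mulr_sumr -big_split; apply: eq_bigr => i _ /=.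
by rewrite !mxE; ring.
Qed.

Lemma dotZl (a : R) u v : dot (a *: u) v = a * dot u v.
Proof. by rewrite /dot mulr_sumr; apply: eq_bigr => i _; rewrite mxE mulrA. Qed.

Lemma dotZr (a : R) u v : dot u (a *: v) = a * dot u v.
Proof. by rewrite dotC dotZl dotC. Qed.

Lemma dotBr u v w : dot u (v - w) = dot u v - dot u w.
Proof. by rewrite -scaleN1r addrC dot_linear; ring. Qed.

Lemma dot_mulmx (A : 'M[R]_(k, l)) u (v : 'cV[R]_l) :
  dot u (A *m v) = dot (A^T *m u) v.
Proof.
have -> : dot u (A *m v) = \sum_i \sum_j u i 0 * A i j * v j 0.
  by apply: eq_bigr => i _; rewrite mxE mulr_sumr; apply: eq_bigr => j _; ring.
rewrite exchange_big; apply: eq_bigr => j _ /=.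
by rewrite mxE mulr_suml; apply: eq_bigr => i _; rewrite !mxE; ring.
Qed.

End Dot.

Section RealDot.
Context {R : realFieldType}.

Lemma dot_ge0 k (u : 'cV[R]_k) : 0 <= dot u u.
Proof. by apply: sumr_ge0 => i _; rewrite -expr2 sqr_ge0. Qed.

(** The inverse of [1] plus the sum of the inverses replaces a minimum and also covers an empty
    index type. *)
Lemma pos_lower_bound (I : finType) (f : I -> R) :
  (forall i, 0 < f i) -> exists2 c, 0 < c & forall i, c <= f i.
Proof.
move=> f0; pose s := 1 + \sum_i (f i)^-1.
have s0 : 0 < s by rewrite ltr_pwDl// sumr_ge0// => i _; rewrite invr_ge0 ltW.
exists s^-1 => [|i]; first by rewrite invr_gt0.
rewrite -[leRHS]invrK lef_pV2 ?posrE ?invr_gt0// /s (bigD1 i)//= addrCA lerDl.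
by rewrite addr_ge0// sumr_ge0// => j _; rewrite invr_ge0 ltW.
Qed.

Lemma upper_bound (I : finType) (f : I -> R) :
  exists2 c, 0 < c & forall i, f i <= c.
Proof.
exists (1 + \sum_i `|f i|) => [|i]; first by rewrite ltr_pwDl// sumr_ge0.
rewrite (bigD1 i)//= addrCA; apply: le_trans (ler_norm _) _.
by rewrite lerDl addr_ge0// sumr_ge0.
Qed.

(** Young's inequality [x a y <= s x^2 + a^2 / (4 s) y^2] is applied to each entry. It serves to
    absorb cross terms at an arbitrarily small cost in the first argument. *)
Lemma dot_mulmx_young k l (A : 'M[R]_(k, l)) (tau : R) : 0 < tau ->
  exists2 c, 0 < c & forall (u : 'cV_k) (v : 'cV_l),
    (* Each [u i 0 ^+ 2] is charged once per column, that is [l] times, and [l * s <= tau]; the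
       successor in [s] avoids a division by zero at [l = 0]. *)
    dot u (A *m v) <= tau * dot u u + c * dot v v.
Proof.
move=> tau0; pose s := tau / l.+1%:R.
have s0 : 0 < s by rewrite divr_gt0.
pose c := 1 + \sum_i \sum_j A i j ^+ 2 / (4 * s).
have c2 i j : 0 <= A i j ^+ 2 / (4 * s).
  by rewrite divr_ge0 ?sqr_ge0// mulr_ge0// ltW.
exists c => [|u v].
  by rewrite ltr_pwDl//; do 2!apply: sumr_ge0 => ? _.
apply: (@le_trans _ _ (\sum_i \sum_j (s * u i 0 ^+ 2 +
    A i j ^+ 2 / (4 * s) * dot v v))).
  apply: ler_sum => i _; rewrite mxE mulr_sumr; apply: ler_sum => j _.
  apply: (@le_trans _ _ (s * u i 0 ^+ 2 + A i j ^+ 2 / (4 * s) * v j 0 ^+ 2)).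
    rewrite -subr_ge0.
    have -> : s * u i 0 ^+ 2 + A i j ^+ 2 / (4 * s) * v j 0 ^+ 2 -
        u i 0 * (A i j * v j 0) =
        (2 * s * u i 0 - A i j * v j 0) ^+ 2 / (4 * s).
      by field; rewrite lt0r_neq0.
    by rewrite divr_ge0 ?sqr_ge0// mulr_ge0// ltW.
  rewrite lerD2l ler_wpM2l// /dot (bigD1 j)//= -expr2 lerDl.
  by apply: sumr_ge0 => ? _; rewrite -expr2 sqr_ge0.
under eq_bigr do rewrite big_split/= sumr_const card_ord -mulr_suml.
rewrite big_split/= -mulr_suml; apply: lerD; last first.
  by rewrite ler_wpM2r ?dot_ge0// lerDr.
rewrite /dot mulr_sumr; apply: ler_sum => i _.
rewrite -mulrnAl -expr2 ler_wpM2r ?sqr_ge0// -mulr_natr /s mulrAC -mulrA.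
by rewrite ger_pMr// ler_pdivrMr// mul1r ler_nat.
Qed.

End RealDot.

Section Laplacian.
Context {R : realFieldType} {n : nat} (e : rel 'I_n) (w : 'I_n -> 'I_n -> R).
Hypothesis ew : weighted_graph e w.

Lemma laplacian_sym : (laplacian e w)^T = laplacian e w.
Proof.
case: ew => es _ ews; apply/matrixP => i j; rewrite !mxE.
rewrite (eq_sym j); case: (eqVneq i j) => [->//|ij]; rewrite !mulr0n es.
by case: (boolP (e i j)) => // /ews[->].
Qed.

Lemma laplacian_row_sum i : \sum_j laplacian e w i j = 0.
Proof.
under eq_bigr do rewrite mxE.
rewrite sumrB (bigD1 i)//= eqxx mulr1n [X in _ + X - _]big1 => [|j ji].
  rewrite addr0 big_mkcond/= -sumrB big1// => j _.
  by case: (e i j); rewrite subrr.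
by rewrite eq_sym (negPf ji).
Qed.

(** Adding the form to its copy with [i] and [j] exchanged yields the sum of the
    [a i j * (x i 0 - x j 0) ^+ 2], where [a] is the weight extended by zero off the edges. *)
Lemma laplacian_psd (x : 'cV[R]_n) : 0 <= dot x (laplacian e w *m x).
Proof.
case: ew => es _ ews.
pose a i j := w i j *+ e i j.
have a_sym i j : a i j = a j i.
  by rewrite /a es; case: (boolP (e j i)) => // /ews[->].
have a0 i j : 0 <= a i j.
  by rewrite /a; case: (boolP (e i j)) => // /ews[_ /ltW].
pose q := \sum_i \sum_j a i j * (x i 0 ^+ 2 - x i 0 * x j 0).
have -> : dot x (laplacian e w *m x) = q.
  apply: eq_bigr => i _; rewrite mxE.
  under eq_bigr => j _ do rewrite mxE mulrBl -/(a i j).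
  rewrite sumrB (bigD1 i)//= eqxx mulr1n.
  rewrite [X in _ + X - _]big1 => [|j ji]; last first.
    by rewrite eq_sym (negPf ji) mul0r.
  rewrite addr0 big_mkcond mulr_suml -sumrB mulr_sumr; apply: eq_bigr => j _ /=.
  by rewrite /a; case: (e i j); rewrite ?mulr1n ?mulr0n; ring.
have qC : q = \sum_i \sum_j a i j * (x j 0 ^+ 2 - x i 0 * x j 0).
  rewrite /q exchange_big; apply: eq_bigr => i _; apply: eq_bigr => j _ /=.
  by rewrite a_sym; ring.
have : 0 <= q + q; last by lra.
rewrite {2}qC -big_split/=; apply: sumr_ge0 => i _.
rewrite -big_split/=; apply: sumr_ge0 => j _.
have -> : a i j * (x i 0 ^+ 2 - x i 0 * x j 0) + a i j *
    (x j 0 ^+ 2 - x i 0 * x j 0) = a i j * (x i 0 - x j 0) ^+ 2 by ring.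
by rewrite mulr_ge0 ?sqr_ge0.
Qed.

End Laplacian.

(** * Coordinates on the state space *)

Definition square_of_coordinates (R : realType) (V : normedModType R)
    (N : V -> R) : Prop :=
  exists (I : finType) (e : I -> V) (p : I -> {linear V -> R^o}),
    [/\ forall v, v = \sum_i p i v *: e i, forall i, continuous (p i) &
        forall v, N v = \sum_i (p i v : R) ^+ 2].

Lemma square_of_coordinates_cV (R : realType) k :
  square_of_coordinates (fun v : 'cV[R]_k => dot v v).
Proof.
have coordL (i : 'I_k) : linear (fun v : 'cV[R]_k => v i 0 : R^o).
  by move=> a u v; rewrite !mxE.
pose p i : {linear 'cV[R]_k -> R^o} := HB.pack (fun v : 'cV[R]_k => v i 0 : R^o)
  (GRing.isLinear.Build _ _ _ _ _ (coordL i)).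
exists 'I_k, (fun i => delta_mx i 0), p.
split=> [v|i|v]; last by apply: eq_bigr => i _; rewrite expr2.
  by rewrite [LHS]matrix_sum_delta; under eq_bigr do rewrite big_ord1.
exact: coord_continuous.
Qed.

Lemma square_of_coordinates_prod (R : realType) (U V : normedModType R)
    (N : U -> R) (M : V -> R) :
  square_of_coordinates N -> square_of_coordinates M ->
  square_of_coordinates (fun x : U * V => N x.1 + M x.2).
Proof.
move=> [I [e [p [eK pc NE]]]] [J [d [q [dK qc ME]]]].
exists (I + J)%type, (fun k => match k with
    inl i => (e i, 0) | inr j => (0, d j) end),
  (fun k => match k with
    inl i => p i \o fst : {linear (U * V)%type -> R^o}
  | inr j => q j \o snd : {linear (U * V)%type -> R^o} end).
split=> [[u v]|[i|j] x|[u v]]; rewrite ?big_sumType//=.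
- apply: injective_projections; rewrite /= !raddf_sum/=.
    by rewrite [X in _ + X]big1 ?addr0// => j _; rewrite scaler0.
  by rewrite [X in X + _]big1 ?add0r// => j _; rewrite scaler0.
- by apply: continuous_comp; [exact: cvg_fst|exact: pc].
- by apply: continuous_comp; [exact: cvg_snd|exact: qc].
- by rewrite NE ME.
Qed.

(** * Energy of the closed loop *)

Section Energy.
Context {R : realType} {n k : nat}.
Variables (m C kw kv kd ki : 'I_n -> R) (Vnom kphi gamma : R).
Variables (LR Leta : 'M[R]_n) (S : 'M[R]_(n, k)).
Hypotheses (m0 : forall i, 0 < m i) (C0 : forall i, 0 < C i)
  (kw0 : forall i, 0 < kw i) (kv0 : forall i, 0 < kv i)
  (kd0 : forall i, 0 < kd i) (ki0 : forall i, 0 < ki i)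
  (Vnom0 : 0 < Vnom) (kphi0 : 0 <= kphi) (gamma0 : 0 < gamma)
  (kphi_gamma : kphi <= 4 * Vnom * gamma).
Hypotheses (LR_sym : LR^T = LR) (LR_psd : forall x, 0 <= dot x (LR *m x))
  (Leta_psd : forall x, 0 <= dot x (Leta *m x))
  (S_LR : S *m (S^T *m LR) = LR).

Local Notation Lphi := (kphi *: LR).
Local Notation St := ('cV[R]_n * 'cV[R]_n * 'cV[R]_n * 'cV[R]_k)%type.

(* The components [w], [V], [h], [f] of a state are [omega], [V], [eta] and
   [phi''] of the system, relative to the equilibrium. *)
Definition energy (b eps : R) (x y : St) : R :=
  \sum_i (kw i * m i / kv i * (x.1.1.1 i 0 * y.1.1.1 i 0)
    + Vnom * C i * (x.1.1.2 i 0 * y.1.1.2 i 0) + x.1.2 i 0 * y.1.2 i 0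
    + eps * (m i * kw i / (kv i * ki i)) *
      (x.1.1.1 i 0 * y.1.2 i 0 + x.1.2 i 0 * y.1.1.1 i 0))
  + dot (S *m x.2) (Lphi *m (S *m y.2)) + b * dot x.2 y.2.

Lemma energyC b eps x y : energy b eps x y = energy b eps y x.
Proof.
rewrite /energy (dotC y.2); congr (_ + _ + _); last first.
  by rewrite dot_mulmx linearZ/= LR_sym dotC.
by apply: eq_bigr => i _; ring.
Qed.

Lemma energy_linear b eps x : linear (energy b eps x : St -> R^o).
Proof.
move=> a y z.
change (energy b eps x (a *: y + z) =
  a * energy b eps x y + energy b eps x z).
rewrite /energy/=.
rewrite mulmxDr -scalemxAr mulmxDr -scalemxAr !dot_linear.
set s := \sum_i _; set s1 := \sum_i _; set s2 := \sum_i _.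
have -> : s = a * s1 + s2.
  rewrite /s /s1 mulr_sumr -big_split; apply: eq_bigr => i _ /=.
  by rewrite !mxE; ring.
ring.
Qed.

Lemma energy_linearl b eps y : linear ((energy b eps)^~ y : St -> R^o).
Proof. by move=> a x z /=; rewrite !(energyC _ _ _ y) energy_linear. Qed.

Definition sqnorm (x : St) : R :=
  dot x.1.1.1 x.1.1.1 + dot x.1.1.2 x.1.1.2 + dot x.1.2 x.1.2 + dot x.2 x.2.

Definition velocity (x dx : St) : Prop :=
  let: (w, V, h, f) := x in let: (dw, dV, dh, df) := dx in
  let z := Lphi *m (S *m f) in
  [/\ forall i, dw i 0 = (m i)^-1 * (- ((kd i + kw i) * w i 0)
        + kv i * V i 0 - kv i / kw i * ki i * h i 0 - z i 0),
      forall i, dV i 0 = (C i)^-1 * (kw i / Vnom * w i 0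
        - (LR *m V) i 0 - kv i / Vnom * V i 0 + Vnom^-1 * z i 0),
      forall i, dh i 0 = ki i * w i 0 - (Leta *m h) i 0 &
      df = S^T *m (diag_mx (\row_i (kw i / kv i)) *m w) - gamma *: f].

Section Rate.
Variables (w V h dw dV dh : 'cV[R]_n) (f df : 'cV[R]_k).
Let x : St := (w, V, h, f).
Let dx : St := (dw, dV, dh, df).
Let z := Lphi *m (S *m f).
Let q := diag_mx (\row_i (kw i / kv i)) *m w.
Hypothesis xdx : velocity x dx.

(** The vector [z] lies in the range of [LR], where [S *m S^T] acts as the identity by [S_LR]; so
    the projection introduced by the [phi] equation disappears. *)
Lemma potential_rate : dot (S *m f) (Lphi *m (S *m df)) =
  dot z q - gamma * dot (S *m f) z.
Proof.
have zE v : dot (S *m f) (Lphi *m v) = dot z v.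
  by rewrite dot_mulmx linearZ/= LR_sym.
case: xdx => _ _ _ ->.
rewrite -/q mulmxBr -scalemxAr mulmxBr -scalemxAr dotBr dotZr -/z.
congr (_ - _).
rewrite zE mulmxA dot_mulmx trmx_mul trmxK /z -!scalemxAl -scalemxAr.
by rewrite !mulmxA -[_ *m S^T *m _]mulmxA -!mulmxA (mulmxA S^T) (mulmxA S) S_LR.
Qed.

(** The weights are chosen for cancellation: the [ki] terms of the [w] and [h] equations cancel,
    [dot z q] cancels the [z] term of the [w] equation, and the remaining products of [w] and [V]
    complete the square of [kw w - kv V]. *)
Lemma energy_rate b eps : energy b eps x dx =
  - \sum_i ((kw i * w i 0 - kv i * V i 0) ^+ 2 / kv i
            + kw i * kd i / kv i * w i 0 ^+ 2)
  - (Vnom * dot V (LR *m V) - dot V z + gamma * dot (S *m f) z)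
  - dot h (Leta *m h)
  + b * (dot f (S^T *m q) - gamma * dot f f)
  + eps * \sum_i (m i * kw i / (kv i * ki i)) *
      (w i 0 * dh i 0 + h i 0 * dw i 0).
Proof.
rewrite /energy/= potential_rate; case: xdx => dwE dVE dhE ->.
rewrite dotBr dotZr.
rewrite big_split/=.
set s1 := \sum_i _; set s2 := \sum_i _; set s3 := \sum_i _; set s4 := \sum_i _.
have -> : s2 = eps * s4 by rewrite mulr_sumr; apply: eq_bigr => i _; ring.
suff -> : s1 = - s3 - Vnom * dot V (LR *m V) + dot V z
    - dot h (Leta *m h) - dot z q.
  ring.
rewrite /s1 /s3 /dot mulr_sumr -!sumrN -!big_split; apply: eq_bigr => i _ /=.
have -> : q i 0 = kw i / kv i * w i 0 by rewrite /q mul_diag_mx !mxE.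
rewrite dwE dVE dhE.
by field; rewrite !lt0r_neq0.
Qed.


(** Completing the square in [V - r *: g] with respect to [LR] leaves
    [kphi * (gamma - kphi / (4 * Vnom))] times the form at [g]. The gain condition makes this
    remainder nonnegative. *)
Lemma coupling_ge0 :
  0 <= Vnom * dot V (LR *m V) - dot V z + gamma * dot (S *m f) z.
Proof.
pose g := S *m f; pose r := kphi / (2 * Vnom).
have gE : dot g (LR *m V) = dot V (LR *m g) by rewrite dot_mulmx LR_sym dotC.
have /(mulr_ge0 (ltW Vnom0)) : 0 <= dot (V - r *: g) (LR *m (V - r *: g)) by [].
rewrite mulmxBr -scalemxAr dotBr dotZr !(dotC (V - _)) !dotBr !dotZr.
rewrite !(dotC (LR *m _)) gE.
rewrite /z -/g -!scalemxAl !dotZr.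
set a := dot V (LR *m V); set b := dot V (LR *m g); set c := dot g _ => H.
have c0 : 0 <= c by exact: LR_psd.
have k0 : 0 <= kphi * (gamma - kphi / (4 * Vnom)) * c.
  rewrite !mulr_ge0// subr_ge0 ler_pdivrMr ?mulr_gt0//.
  by rewrite mulrC.
suff -> : Vnom * a - kphi * b + gamma * (kphi * c) =
    Vnom * (a - r * b - r * (b - r * c)) +
    kphi * (gamma - kphi / (4 * Vnom)) * c by rewrite addr_ge0.
by rewrite /r; field; rewrite lt0r_neq0.
Qed.

End Rate.

Lemma friction_ge : exists2 c, 0 < c & forall w V : 'cV[R]_n,
  c * (dot w w + dot V V) <=
  \sum_i ((kw i * w i 0 - kv i * V i 0) ^+ 2 / kv i
            + kw i * kd i / kv i * w i 0 ^+ 2).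
Proof.
(* With [u = kw w - kv V], [kv^2 V^2 <= 2 (kw^2 w^2 + u^2)]; [r i] is small
   enough for both resulting coefficients of [w^2] and [u^2]. *)
pose r i :=
  ((1 + 2 * kw i ^+ 2 / kv i ^+ 2) / (kw i * kd i / kv i) + 2 / kv i)^-1.
have a0 i : 0 < kw i * kd i / kv i by rewrite !mulr_gt0// invr_gt0.
have b0 i : 0 < 1 + 2 * kw i ^+ 2 / kv i ^+ 2.
  by rewrite ltr_pwDl// divr_ge0 ?sqr_ge0// mulr_ge0 ?sqr_ge0.
have p1 i : 0 < (1 + 2 * kw i ^+ 2 / kv i ^+ 2) / (kw i * kd i / kv i).
  exact: divr_gt0.
have p2 i : 0 < 2 / kv i by rewrite divr_gt0.
have r0 i : 0 < r i by rewrite invr_gt0 addr_gt0.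
have [c c0 cr] := pos_lower_bound r0.
exists c => // w V; rewrite -big_split mulr_sumr; apply: ler_sum => i _ /=.
apply: (@le_trans _ _ (r i * (w i 0 ^+ 2 + V i 0 ^+ 2))).
  by rewrite -!expr2 ler_wpM2r// addr_ge0 ?sqr_ge0.
set a := kw i * kd i / kv i.
have r1 : r i * (1 + 2 * kw i ^+ 2 / kv i ^+ 2) <= a.
  rewrite /r -/a mulrC ler_pdivrMr ?addr_gt0// mulrDr [a * (_ / a)]mulrC.
  by rewrite divfK ?lt0r_neq0 ?a0// lerDl ltW// mulr_gt0 ?a0.
have r2 : r i * (2 / kv i) <= 1.
  by rewrite /r mulrC ler_pdivrMr ?addr_gt0// mul1r lerDr ltW.
set u := kw i * w i 0 - kv i * V i 0.
have VE : V i 0 ^+ 2 <= 2 * (kw i ^+ 2 * w i 0 ^+ 2 + u ^+ 2) / kv i ^+ 2.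
  rewrite ler_pdivlMr ?exprn_gt0// -subr_ge0.
  suff -> : 2 * (kw i ^+ 2 * w i 0 ^+ 2 + u ^+ 2) - V i 0 ^+ 2 * kv i ^+ 2 =
    (kw i * w i 0 + u) ^+ 2 by rewrite sqr_ge0.
  by rewrite /u; ring.
set v2 := 2 * (kw i ^+ 2 * w i 0 ^+ 2 + u ^+ 2) / kv i ^+ 2 in VE.
apply: (@le_trans _ _ (r i * (w i 0 ^+ 2 + v2))).
  by rewrite ler_wpM2l ?lerD2l// ltW.
have -> : r i * (w i 0 ^+ 2 + v2) = r i * (2 / kv i) * (u ^+ 2 / kv i) +
    r i * (1 + 2 * kw i ^+ 2 / kv i ^+ 2) * w i 0 ^+ 2.
  by rewrite /v2; field; rewrite lt0r_neq0.
apply: lerD; last by rewrite ler_wpM2r ?sqr_ge0.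
by rewrite ler_piMl// divr_ge0 ?sqr_ge0// ltW.
Qed.

(** Half of the damping in [f] absorbs the cross term; the cost in [w] is later paid by the
    friction. *)
Lemma diffusion_le : exists2 c, 0 < c & forall (w : 'cV[R]_n) (f : 'cV[R]_k),
  dot f (S^T *m (diag_mx (\row_i (kw i / kv i)) *m w)) - gamma * dot f f <=
  - (gamma / 2) * dot f f + c * dot w w.
Proof.
have [c c0 cP] := dot_mulmx_young (S^T *m diag_mx (\row_i (kw i / kv i)))
  (divr_gt0 gamma0 (ltr0Sn _ 1)).
by exists c => // w f; have := cP f w; rewrite mulmxA; lra.
Qed.

(** The weight [m kw / (kv ki)] is the one for which the integral action in [dw] contributes exactly
    [- dot h h]. All other terms are handled by Young's inequality. *)
Lemma integral_le : exists2 c, 0 < c &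
  forall (w V h dw dV dh : 'cV[R]_n) (f df : 'cV[R]_k),
  velocity (w, V, h, f) (dw, dV, dh, df) ->
  \sum_i (m i * kw i / (kv i * ki i)) * (w i 0 * dh i 0 + h i 0 * dw i 0) <=
  - (2^-1) * dot h h + c * (dot w w + dot V V + dot f f).
Proof.
pose D (g : 'I_n -> R) := diag_mx (\row_i g i).
pose al i := kw i / (kv i * ki i).
pose A1 := D (fun i => m i * al i * ki i).
(* Transposed so that [h] comes first, in the argument with the small coefficient. *)
pose A2 := (- (D (fun i => m i * al i) *m Leta))^T.
pose A3 := D (fun i => - al i * (kd i + kw i)).
pose A4 := D (fun i => al i * kv i).
pose A5 := D (fun i => - al i) *m (Lphi *m S).
(* Four of the five terms have [h] as first argument, so together they use half of [dot h h]. The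
   term in [A1] costs an eighth of [dot w w], covered by the [1] in the constant below. *)
have e8 : 0 < 8^-1 :> R by rewrite invr_gt0.
have [c1 c10 H1] := dot_mulmx_young A1 e8.
have [c2 c20 H2] := dot_mulmx_young A2 e8.
have [c3 c30 H3] := dot_mulmx_young A3 e8.
have [c4 c40 H4] := dot_mulmx_young A4 e8.
have [c5 c50 H5] := dot_mulmx_young A5 e8.
exists (1 + c1 + c2 + c3 + c4 + c5); first by rewrite !addr_gt0.
move=> w V h dw dV dh f df [dwE _ dhE _].
have -> : \sum_i (m i * kw i / (kv i * ki i)) *
    (w i 0 * dh i 0 + h i 0 * dw i 0) =
  dot w (A1 *m w) + dot h (A2 *m w) + dot h (A3 *m w) + dot h (A4 *m V)
  + dot h (A5 *m f) - dot h h.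
  have -> : dot h (A2 *m w) =
      dot w ((- (D (fun i => m i * al i) *m Leta)) *m h).
    by rewrite dot_mulmx trmxK dotC.
  have DE g (v : 'cV_n) i : (D g *m v) i 0 = g i * v i 0.
    by rewrite mul_diag_mx !mxE.
  have NE (v : 'cV[R]_n) i : (- v) i 0 = - v i 0 by rewrite mxE.
  rewrite /dot -sumrN -!big_split; apply: eq_bigr => i _ /=.
  rewrite dwE dhE mulNmx NE /A5 -!mulmxA !DE /al.
  by field; rewrite !lt0r_neq0.
have := H1 w w; have := H2 h w; have := H3 h w; have := H4 h V; have := H5 h f.
have := dot_ge0 w; have := dot_ge0 V; have := dot_ge0 f; have := dot_ge0 h.
nra.
Qed.

Lemma energy_lyapunov : exists b eps a c : R,
  [/\ 0 < a, 0 < c, forall x, a * sqnorm x <= energy b eps x x &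
      forall x dx, velocity x dx ->
        energy b eps dx x + energy b eps x dx <= - c * sqnorm x].
Proof.
have [c0 c00 H0] := friction_ge.
have [c1 c10 H1] := diffusion_le.
have [c2 c20 H2] := integral_le.
have [c3 c30 H3] := upper_bound (fun i => m i * kw i / (kv i * ki i)).
have [c4 c40 H4] : exists2 c, 0 < c & forall i, c <= kw i * m i / kv i.
  by apply: pos_lower_bound => i; rewrite divr_gt0// mulr_gt0.
have [c5 c50 H5] : exists2 c, 0 < c & forall i, c <= Vnom * C i.
  by apply: pos_lower_bound => i; rewrite mulr_gt0.
(* The [w] cost of the [b] term is then half of the friction. *)
pose b := c0 / (2 * c1).
have b0 : 0 < b by rewrite divr_gt0 ?mulr_gt0.
have bc1 : b * c1 = c0 / 2 by rewrite /b; field; rewrite lt0r_neq0.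
have bg0 : 0 < b * gamma by rewrite mulr_gt0.
(* The first two bounds let the cross term spend at most half of the dissipation left in [w], [V]
   and [f]; the last two keep it below half of the diagonal part of the energy. *)
have [eps e0 [e1 e2 e3 e4]] : exists2 eps, 0 < eps &
    [/\ eps * c2 <= c0 / 4, eps * c2 <= b * gamma / 4, eps * c3 <= c4 / 2 &
        eps * c3 <= 2^-1].
  exists (Num.min (Num.min (c0 / 4 / c2) (b * gamma / 4 / c2))
                  (Num.min (c4 / 2 / c3) (2^-1 / c3))).
    by rewrite !lt_min !divr_gt0.
  by split; rewrite -ler_pdivlMr// !ge_min lexx ?orbT.
have [a a0 [a1 a2 a3 a4]] : exists2 a, 0 < a &
    [/\ a <= c4 / 2, a <= c5, a <= 2^-1 & a <= b].
  exists (Num.min (Num.min (c4 / 2) c5) (Num.min 2^-1 b)).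
    by rewrite !lt_min c50 b0 divr_gt0// invr_gt0 ltr0n.
  by split; rewrite !ge_min lexx ?orbT.
(* The dissipation left in half the derivative is [c0 / 4] in [w] and [V], [b * gamma / 4] in [f]
   and [eps / 2] in [h]; the full derivative doubles these. *)
have [c cc0 [d1 d2 d3]] : exists2 c, 0 < c &
    [/\ c <= c0 / 2, c <= b * gamma / 2 & c <= eps].
  exists (Num.min (Num.min (c0 / 2) (b * gamma / 2)) eps).
    by rewrite !lt_min e0 !divr_gt0.
  by split; rewrite !ge_min lexx ?orbT.
exists b, eps, a, c; split=> //.
- move=> [[[w V] h] f]; rewrite /sqnorm /energy/= mulrDr.
  apply: lerD; last first.
    by rewrite ler_wpM2r ?dot_ge0.
  apply: ler_wpDr; first by rewrite -scalemxAl dotZr mulr_ge0.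
  rewrite /dot -!big_split mulr_sumr; apply: ler_sum => i _ /=.
  have := H3 i; have := H4 i; have := H5 i.
  have : 0 < m i * kw i / (kv i * ki i) by rewrite divr_gt0 ?mulr_gt0.
  set nu := m i * kw i / (kv i * ki i); set C1 := Vnom * C i.
  set m1 := kw i * m i / kv i => nu0 C1c m1c nuc.
  set p := w i 0; set q := V i 0; set r := h i 0.
  have enu : eps * nu <= eps * c3 by rewrite ler_pM2l.
  have enu1 : eps * nu <= c4 / 2 by exact: le_trans e3.
  have enu2 : eps * nu <= 2^-1 by exact: le_trans e4.
  have en0 : 0 <= eps * nu by rewrite mulr_ge0 ?ltW.
  have q1 : a * (q * q) <= C1 * (q * q).
    by rewrite ler_wpM2r -?expr2 ?sqr_ge0// (le_trans a2).
  have q2 : a * (p * p) + eps * nu * (p * p) <= m1 * (p * p).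
    by rewrite -mulrDl ler_wpM2r -?expr2 ?sqr_ge0//; lra.
  have q3 : a * (r * r) + eps * nu * (r * r) <= r * r.
    by rewrite -mulrDl ler_piMl -?expr2 ?sqr_ge0//; lra.
  (* The cross term is bounded below through this square, at the cost of the two diagonal terms
     reserved in [q2] and [q3]. *)
  have q4 : 0 <= eps * nu * (p + r) ^+ 2 by rewrite mulr_ge0 ?sqr_ge0.
  suff : eps * nu * (p * r + r * p) = eps * nu * (p + r) ^+ 2 -
    eps * nu * (p * p) - eps * nu * (r * r) by lra.
  by ring.
- move=> [[[w V] h] f] [[[dw dV] dh] df] xdx.
  rewrite energyC (energy_rate xdx).
  have g0 := coupling_ge0 V f.
  have := H0 w V; have := H2 _ _ _ _ _ _ _ _ xdx; have := H1 w f.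
  have := Leta_psd h.
  rewrite /sqnorm/=.
  have := dot_ge0 w; have := dot_ge0 V; have := dot_ge0 h; have := dot_ge0 f.
  move: g0.
  set s1 := Vnom * _ - _ + _.
  set s2 := \sum_i _; set s3 := \sum_i _; set s4 := _ - gamma * _.
  set W := dot w w; set V2 := dot V V; set H := dot h h; set F := dot f f.
  set Y := dot h _.
  move=> s10 F0 H0' V0 W0 Y0 s4le s2le s3le.
  have t4 : b * s4 <= - (b * gamma / 2 * F) + c0 / 2 * W.
    by have := ler_wpM2l (ltW b0) s4le; rewrite -bc1; lra.
  have t2 : eps * s2 <= - (eps / 2 * H) + eps * c2 * (W + V2) + eps * c2 * F.
    by have := ler_wpM2l (ltW e0) s2le; lra.
  have WV0 : 0 <= W + V2 by exact: addr_ge0.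
  have := ler_wpM2r WV0 e1; have := ler_wpM2r F0 e2.
  have := ler_wpM2r WV0 d1; have := ler_wpM2r F0 d2; have := ler_wpM2r H0' d3.
  have := mulr_ge0 (ltW c00) V0.
  lra.
Qed.

End Energy.

(** * Stability of the closed loop *)

Lemma pos_diag_mxE (R : realFieldType) n (A : 'M[R]_n) :
  pos_diag_mx A -> A = diag_mx (\row_i A i i).
Proof.
move=> [/is_diag_mxP Ad _]; apply/matrixP => i j; rewrite !mxE.
by case: eqVneq => [->//|ij]; rewrite Ad.
Qed.

Lemma invmx_pos_diag (R : realFieldType) n (A : 'M[R]_n) :
  pos_diag_mx A -> invmx A = diag_mx (\row_i (A i i)^-1).
Proof.
move=> Ad; set B := diag_mx _.
have AB : A *m B = 1%:M.
  rewrite (pos_diag_mxE Ad) mulmx_diag -diag_const_mx; congr diag_mx.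
  by apply/rowP => i; rewrite !mxE divff// lt0r_neq0//; case: Ad.
by rewrite -[B](mulKmx (mulmx1_unit AB).1) AB mulmx1.
Qed.

(** Orthogonality gives [S *m S^T = 1 - u *m u^T], and [u^T *m A = 0] because the columns of [A] sum
    to zero. *)
Lemma orthogonal_complement_proj (R : rcfType) n (A : 'M[R]_n)
    (S : 'M[R]_(n, n.-1)) :
  orthogonal_mx (row_mx (const_mx (Num.sqrt n%:R)^-1 : 'cV[R]_n) S) ->
  (forall i, \sum_j A j i = 0) -> S *m (S^T *m A) = A.
Proof.
set u := const_mx _ => -[_ uS] A1.
have uA : u^T *m A = 0.
  apply/matrixP => i j; rewrite !mxE.
  by under eq_bigr do rewrite !mxE; rewrite -mulr_sumr A1 mulr0.
rewrite tr_row_mx mul_row_col in uS.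
by rewrite mulmxA -[S *m _](addKr (u *m u^T)) uS mulmxDl mulNmx -mulmxA uA
  mulmx0 oppr0 add0r mul1mx.
Qed.

(* For [n = 1] both Laplacians and the state component [phi] vanish, so [kphi]
   and [gamma] carry no sign information and are replaced by [0] and [1]. *)
Lemma normalized_gains (R : realType) n (eR ephi : rel 'I_n)
    (w wphi : 'I_n -> 'I_n -> R) (kphi gamma Vnom : R) :
  (0 < n)%N -> 0 < Vnom -> weighted_graph eR w -> graph_connected eR ->
  weighted_graph ephi wphi -> laplacian ephi wphi = kphi *: laplacian eR w ->
  kphi / (4 * Vnom) < gamma ->
  exists kphi' gamma' : R, [/\ 0 <= kphi', 0 < gamma',
    kphi' <= 4 * Vnom * gamma',
    laplacian ephi wphi = kphi' *: laplacian eR w &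
    forall f : 'cV[R]_n.-1, gamma *: f = gamma' *: f].
Proof.
move=> n0 V0 [es ei ew] ec [_ _ pw] Lk kg.
case: (ltngtP n 1) => [|n1|n1]; first by rewrite ltnNge n0.
- have k0 : 0 <= kphi.
    (* With two vertices, connectedness provides an edge from [i] to some [l]; comparing the entries
       of the two Laplacians at [i], [l] fixes the sign of [kphi]. *)
    pose i := Ordinal n0; pose j := Ordinal n1.
    have [p] := connectP (ec i j).
    case: p => [_ /(congr1 val)//|l p /= /andP[il _] _].
    have li : i != l by apply: contraTneq il => <-; rewrite ei.
    have /matrixP/(_ i l) := Lk.
    rewrite !mxE (negPf li) !mulr0n !sub0r il mulr1n.
    have [_ wil] := ew _ _ il.
    move=> Lil; rewrite -(pmulr_lge0 _ wil) -[leRHS]opprK -mulrN -Lil opprK.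
    by case: (boolP (ephi i l)) => // /pw[_ /ltW].
  exists kphi, gamma; split=> //.
    by apply: le_lt_trans kg; rewrite divr_ge0// mulr_ge0// ltW.
  by rewrite mulrC -ler_pdivrMr ?mulr_gt0// ltW.
- exists 0, 1; split=> //; first by rewrite mulr_ge0// mulr_ge0// ltW.
    rewrite scale0r Lk (_ : laplacian eR w = 0) ?scaler0//.
    have ordE (i j : 'I_n) : i = j.
      have lt1 (l : 'I_n) : (l < 1)%N := leq_trans (ltn_ord l) (eq_leq n1).
      apply/val_inj => /=; move: (lt1 i) (lt1 j).
      by rewrite !ltnS !leqn0 => /eqP-> /eqP->.
    apply/matrixP => i j; have := laplacian_row_sum eR w i.
    rewrite (bigD1 j)//= big1 ?addr0 => [->|l]; first by rewrite mxE.
    by rewrite (ordE l j) eqxx.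
  move=> f; apply/matrixP => i.
  by have := leq_trans (ltn_ord i) (eq_leq (congr1 predn n1)).
Qed.

Lemma closed_loop_linear (R : realType) (n : nat)
    (M E Komega KV Kdroop KdroopI LR Leta Lphi : 'M[R]_n)
    (S : 'M[R]_(n, n.-1)) (Vnom gamma : R) :
  linear (closed_loop M E Komega KV Kdroop KdroopI LR Leta Lphi S 0 Vnom gamma).
Proof.
have addE k (u v : 'cV[R]_k) i j : (u + v) i j = u i j + v i j by rewrite mxE.
have oppE k (u : 'cV[R]_k) i j : (- u) i j = - u i j by rewrite mxE.
have scaleE k c (u : 'cV[R]_k) i j : (c *: u) i j = c * u i j by rewrite mxE.
move=> a [[[w V] h] f] [[[w' V'] h'] f'].
congr (_, _, _, _); apply/matrixP => i j /=;
  rewrite !(mulmxDr, mulmxN) -!scalemxAr ?mulmx0 !(addE, oppE, scaleE) ?mxE;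
  ring.
Qed.

Lemma closed_loop_affine (R : realType) (n : nat)
    (M E Komega KV Kdroop KdroopI LR Leta Lphi : 'M[R]_n)
    (S : 'M[R]_(n, n.-1)) (Pm : 'cV[R]_n) (Vnom gamma : R) (x : state R n) :
  closed_loop M E Komega KV Kdroop KdroopI LR Leta Lphi S Pm Vnom gamma x =
  closed_loop M E Komega KV Kdroop KdroopI LR Leta Lphi S 0 Vnom gamma x +
  (M *m Pm, 0, 0, 0).
Proof.
case: x => [[[w V] h] f]; congr (_, _, _, _); rewrite /= addr0//.
by rewrite -mulmxDr.
Qed.

Lemma closed_loop_velocity (R : realType) (n : nat) (m C : 'I_n -> R)
    (Komega KV Kdroop KdroopI LR Leta : 'M[R]_n) (S : 'M[R]_(n, n.-1))
    (Vnom kphi gamma : R) (x : state R n) :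
  pos_diag_mx Komega -> pos_diag_mx KV ->
  pos_diag_mx Kdroop -> pos_diag_mx KdroopI ->
  velocity m C (fun i => Komega i i) (fun i => KV i i) (fun i => Kdroop i i)
    (fun i => KdroopI i i) Vnom kphi gamma LR Leta S x
    (closed_loop (diag_mx (\row_i (m i)^-1)) (diag_mx (\row_i (C i)^-1))
      Komega KV Kdroop KdroopI LR Leta (kphi *: LR) S 0 Vnom gamma x).
Proof.
move=> Kwd Kvd Kdd Kid; case: x => [[[w V] h] f].
have DE (d : 'I_n -> R) (v : 'cV[R]_n) i :
    (diag_mx (\row_i d i) *m v) i 0 = d i * v i 0.
  by rewrite mul_diag_mx !mxE.
(* Restricted versions of [mxE]: entries of products with [LR] and [Leta] must stay folded for
   [ring]. *)
have addE k (u v : 'cV[R]_k) i j : (u + v) i j = u i j + v i j by rewrite mxE.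
have oppE k (u : 'cV[R]_k) i j : (- u) i j = - u i j by rewrite mxE.
have scaleE k c (u : 'cV[R]_k) i j : (c *: u) i j = c * u i j by rewrite mxE.
have KE A (v : 'cV[R]_n) i : pos_diag_mx A -> (A *m v) i 0 = A i i * v i 0.
  by move=> /pos_diag_mxE {1}->; rewrite DE.
have VE A (v : 'cV[R]_n) i : pos_diag_mx A ->
    (invmx A *m v) i 0 = (A i i)^-1 * v i 0.
  by move=> /invmx_pos_diag ->; rewrite DE.
pose diagE := (addE, oppE, scaleE, DE, fun v i => KE _ v i Kwd,
  fun v i => KE _ v i Kvd, fun v i => KE _ v i Kdd, fun v i => KE _ v i Kid,
  fun v i => VE _ v i Kwd, fun v i => VE _ v i Kvd).
split=> [i|i|i|].
- by rewrite addr0 -!mulmxA mulmxDl !diagE; ring.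
- by rewrite -!mulmxA mulmxDl -(scalemxAl _ KV) !diagE; ring.
- by rewrite !diagE.
- rewrite -!mulmxA; congr (_ *m _ - _); apply/colP => i.
  by rewrite !diagE; ring.
Qed.

Lemma lyapunov_affine (R : realType) n (L0 : state R n -> state R n)
    (u : state R n) (B : state R n -> state R n -> R) (a c : R) :
  linear L0 ->
  (forall v, linear (B^~ v : state R n -> R^o)) ->
  (forall v, linear (B v : state R n -> R^o)) ->
  0 < a -> 0 < c ->
  (forall v, a * sqnorm v <= B v v) ->
  (forall v, B (L0 v) v + B v (L0 v) <= - c * sqnorm v) ->
  exists2 xe, unique (is_equilibrium (fun x => L0 x + u)) xe &
    globally_asymptotically_stable (fun x => L0 x + u) xe.
Proof.
move=> linL linBl linBr a0 c0 Bpos.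
pose L : {linear state R n -> state R n} :=
  HB.pack L0 (GRing.isLinear.Build _ _ _ _ _ linL).
rewrite -[L0]/(L : _ -> _) => BL.
have [I [e [p [eK pc pE]]]] := square_of_coordinates_prod
  (square_of_coordinates_prod
    (square_of_coordinates_prod (square_of_coordinates_cV R n)
      (square_of_coordinates_cV R n)) (square_of_coordinates_cV R n))
  (square_of_coordinates_cV R n.-1).
(* On the kernel of [L] the dissipation bound reads [0 <= - c * sqnorm v]. *)
have Linj v : L v = 0 -> v = 0.
  have lin0 (f : state R n -> R^o) : linear f -> f 0 = 0.
    by move=> /(_ (-1) 0 0); rewrite scaler0 addr0 scaleN1r addNr.
  move=> Lv; have := BL v.
  rewrite Lv (lin0 _ (linBl v)) (lin0 _ (linBr v)) addr0 mulNr oppr_ge0.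
  rewrite pmulr_rle0// [sqnorm v]pE => p0; rewrite [v]eK big1// => i _.
  suff -> : p i v = 0 by rewrite scale0r.
  apply/eqP; rewrite -(@sqrf_eq0 R) eq_le sqr_ge0 andbT.
  exact: le_trans (coord_sqr_le p i v) p0.
have Lker : lker (linfun L) == 0%VS.
  apply/lker0P => x y; rewrite !lfunE => Lxy.
  by apply/subr0_eq/Linj; rewrite linearB Lxy subrr.
(* In finite dimension injectivity gives surjectivity, so [L xe = - u] is solvable. *)
pose xe : state R n := ((linfun L)^-1%VF (- u)).
have Lxe : L xe = - u.
  by have := lker0_lfunVK Lker (- u); rewrite lfunE.
have FE : (fun x => L x + u) = fun x => L (x - xe).
  by apply/funext => x; rewrite linearB Lxe opprK.
exists xe.
  split=> [|x]; first by rewrite /is_equilibrium Lxe addNr.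
  by rewrite FE /is_equilibrium => /Linj/subr0_eq.
rewrite FE; apply: (lyapunov_linear eK pc xe linBl linBr a0 c0) => v.
  by rewrite -[\sum_i _]pE; exact: Bpos.
by rewrite -[\sum_i _]pE; exact: BL.
Qed.

Theorem theorem1 (R : realType) (n : nat)
    (m C : 'I_n -> R) (Vnom : R)
    (Komega KV Kdroop KdroopI : 'M[R]_n) (Pm : 'cV[R]_n)
    (eR eeta ephi : rel 'I_n)
    (resistance ceta cphi : 'I_n -> 'I_n -> R)
    (S : 'M[R]_(n, n.-1)) (kphi gamma : R) :
  let M := diag_mx (\row_i (m i)^-1) in
  let E := diag_mx (\row_i (C i)^-1) in
  let LR := laplacian eR (fun i j => (resistance i j)^-1) in
  let Leta := laplacian eeta ceta in
  let Lphi := laplacian ephi cphi in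
  (0 < n)%N ->
  (forall i, 0 < m i) ->
  (forall i, 0 < C i) ->
  0 < Vnom ->
  pos_diag_mx Komega -> pos_diag_mx KV ->
  pos_diag_mx Kdroop -> pos_diag_mx KdroopI ->
  weighted_graph eR (fun i j => (resistance i j)^-1) ->
  graph_connected eR ->
  weighted_graph eeta ceta ->
  weighted_graph ephi cphi ->
  orthogonal_mx (row_mx (const_mx (Num.sqrt n%:R)^-1 : 'cV[R]_n) S) ->
  Lphi = kphi *: LR ->
  kphi / (4 * Vnom) < gamma ->
  let F := closed_loop M E Komega KV Kdroop KdroopI LR Leta Lphi S Pm
             Vnom gamma in
  exists2 xe : state R n,
    unique (is_equilibrium F) xe & globally_asymptotically_stable F xe.
Proof.
move=> M E LR Leta Lphi n0 m0 C0 V0 Kwd Kvd Kdd Kid eRw eRc eeta_w ephi_w.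
move=> Sorth Lk kg F.
have [k' [g' [k0 g0 kg' Lk' gE]]] :=
  normalized_gains n0 V0 eRw eRc ephi_w Lk kg.
pose L := closed_loop M E Komega KV Kdroop KdroopI LR Leta Lphi S 0 Vnom gamma.
have -> : F = fun x => L x + (M *m Pm, 0, 0, 0).
  by apply/funext => x; rewrite /F closed_loop_affine.
have LR_sym : LR^T = LR := laplacian_sym eRw.
have LR0 i : \sum_j LR j i = 0.
  rewrite -[RHS](laplacian_row_sum eR (fun i j => (resistance i j)^-1) i).
  by apply: eq_bigr => j _; rewrite -[in LHS]LR_sym mxE.
have [b [eps [a [c [a0 c0 Bpos BL]]]]] := energy_lyapunov m0 C0 Kwd.2 Kvd.2
  Kdd.2 Kid.2 V0 k0 g0 kg' LR_sym (laplacian_psd eRw) (laplacian_psd eeta_w)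
  (orthogonal_complement_proj Sorth LR0).
apply: (lyapunov_affine _ _ _ _ a0 c0 Bpos) => [|y|y|x].
- exact: closed_loop_linear.
- exact: energy_linearl.
- exact: energy_linear.
apply: BL.
(* The normalized gains [k'] and [g'] define the same vector field, so the energy built from them
   applies. *)
have -> : L x = closed_loop M E Komega KV Kdroop KdroopI LR Leta (k' *: LR) S 0
    Vnom g' x.
  by rewrite /L [Lphi]Lk'; case: (x) => [[[w V] h] f] /=; rewrite gE.
exact: closed_loop_velocity.
Qed.
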